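(* Let $(\mathcal{G},d)$ be a Busemann space and let $T:\mathcal{G}\to\mathcal{G}$ be $\gamma$-Lipschitz on $\mathcal{G}$ for some $\gamma>0$. Let $\lambda\in(0,1)$, $x_0\in\mathcal{G}$, and define $x_{k+1}=\lambda x_0\oplus(1-\lambda)T(x_k)$ for $k\ge0$. Then for all $k\ge1$, $$d(T(x_k),x_k)\le(1-\lambda)^k\gamma^k d(T(x_0),x_0)+\frac{\lambda}{1-\lambda}d(x_0,x_k).$$ If $\gamma\in(0,1]$ and $x_*$ is a fixed point of $T$, then further $$d(T(x_k),x_k)\le(1-\lambda)^k\gamma^k d(T(x_0),x_0)+\frac{2\lambda}{1-\lambda}d(x_0,x_* ).$$ As a consequence, for $\gamma\in(0,1]$, given any $\epsilon>0$, if $\lambda=\frac{\epsilon}{4D_*+\epsilon}$, where $D_*\ge d(x_0,x_* )$, then $d(T(x_k),x_k)\le\epsilon$ after at most $k$ iterations, where $$k=\Big\lceil\frac{\ln(2d(T(x_0),x_0)/\epsilon)}{\ln(1/(1-\lambda))+\ln(1/\gamma)}\Big\rceil=\mathcal{O}\Big(\frac{\ln(d(T(x_0),x_0)/\epsilon)}{\epsilon/D_*+\ln(1/\gamma)}\Big).$$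
   Context: A Busemann space is a geodesic metric space $(\mathcal{G},d)$ whose metric is convex along geodesics: for any two geodesics $x,y:[0,1]\to\mathcal{G}$ (parametrized proportionally to arc length), $t\mapsto d(x(t),y(t))$ is convex on $[0,1]$. $\lambda x\oplus(1-\lambda)y$ denotes the point $z$ on the geodesic from $x$ to $y$ with $d(z,x)=(1-\lambda)d(x,y)$. $T$ is $\gamma$-Lipschitz if $d(T(x),T(y))\le\gamma\,d(x,y)$ for all $x,y\in\mathcal{G}$. A fixed point satisfies $T(x_* )=x_*$. $f=\mathcal{O}(g)$ means that there is a constant $C>0$, independent of $f,g$, with $f\le Cg$.
   Formalization: The O-bound fails literally (at ε = d(T(x_0),x_0) it is 0 while k ≥ 1); it is proved with a constant C(δ), for each δ > 0, whenever d(T(x_0),x_0)/ε ≥ 1+δ and the expression inside O is at least δ. *)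

(* Defs.v *)
From HB Require Import structures.
From mathcomp Require Import all_boot all_order all_algebra.
From mathcomp Require Import all_classical all_reals all_analysis.
From mathcomp Require Import lra.

Set Implicit Arguments.
Unset Strict Implicit.
Unset Printing Implicit Defensive.

Import Order.TTheory GRing.Theory Num.Theory.
Import numFieldNormedType.Exports.

Local Open Scope classical_set_scope.
Local Open Scope ring_scope.

Section Busemann.
Context {R : realType} {G : metricType R}.
Implicit Types (x y z : G) (c : R -> G) (lambda : R).

(* A geodesic [0,1] -> G is represented by a total map on R, of which only the
   restriction to [0,1] matters. *)
Definition geodesic c :=
  forall s t, 0 <= s <= 1 -> 0 <= t <= 1 ->
    mdist (c s) (c t) = `|s - t| * mdist (c 0) (c 1).

Definition geodesic_between x y c := [/\ c 0 = x, c 1 = y & geodesic c].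

Definition on_geodesic lambda x y : set G :=
  [set z | exists c, [/\ geodesic_between x y c, (c @` `[0, 1]%classic) z &
                         mdist z x = (1 - lambda) * mdist x y]].

(* lambda x (+) (1 - lambda) y; it is a junk value unless [on_geodesic lambda x y]
   is inhabited, which it is in every geodesic space when 0 <= lambda <= 1. *)
Definition gcomb lambda x y : G := xget x (on_geodesic lambda x y).

End Busemann.

Definition busemann (R : realType) (G : metricType R) :=
  (forall x y : G, exists c, geodesic_between x y c) /\
  (forall c c' : R -> G, geodesic c -> geodesic c' ->
     convex_function (E := R^o) `[0, 1]%classic
       (fun t : R => mdist (c t) (c' t))).

Lemma on_geodesic_unique (R : realType) (G : metricType R) (lambda : R)
    (x y z z' : G) : busemann G ->
  on_geodesic lambda x y z -> on_geodesic lambda x y z' -> z = z'.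
Proof.
move=> [_ cvx] [c [[c0 c1 gc] [a a01 <-]]] + [c' [[c'0 c'1 gc'] [b b01 <-]]].
move: a01 b01 => /=; rewrite !in_itv/= => a01 b01.
have I0 : 0 <= (0 : R) <= 1 by rewrite lexx ler01.
have dE e (f : R -> G) : geodesic f -> f 0 = x -> f 1 = y ->
    0 <= e <= 1 -> mdist (f e) x = e * mdist x y.
  by move=> gf f0 f1 e01; rewrite -{1}f0 gf// f0 f1 subr0 ger0_norm; lra.
rewrite !dE// => da db.
have [xy|xy] := eqVneq (mdist x y) 0.
  have fx (f : R -> G) t : geodesic f -> f 0 = x -> f 1 = y ->
      0 <= t <= 1 -> f t = x.
    by move=> *; apply: mdist_positivity; rewrite dE// xy mulr0.
  by rewrite (fx c a) ?(fx c' b).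
have ab : a = b by apply: (@mulIf _ (mdist x y)); [|rewrite da db].
rewrite -ab; apply: mdist_positivity; apply: le_anti; rewrite mdist_ge0 andbT.
have /andP[a0 a1] := a01.
have := cvx c c' gc gc' (Itv01 a0 a1) 1 0.
rewrite !inE/= !in_itv/= !lexx ler01 => /(_ isT isT).
have -> : conv (Itv01 a0 a1) (1 : convex_lmodType R^o) 0 = a.
  by rewrite /conv/= scaler0 addr0 /GRing.scale/= mulr1.
by rewrite convRE c0 c'0 c1 c'1 !mdistxx !mulr0 addr0.
Qed.

Lemma gcombP (R : realType) (G : metricType R) (lambda : R) (x y z : G) :
  busemann G -> 0 <= lambda <= 1 ->
  on_geodesic lambda x y z <-> z = gcomb lambda x y.
Proof.
move=> bG l01.
have ex : on_geodesic lambda x y (gcomb lambda x y).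
  have [c [c0 c1 gc]] := bG.1 x y; rewrite /gcomb.
  apply: (xgetPex x); exists (c (1 - lambda)); exists c; split=> //.
    by exists (1 - lambda) => //=; rewrite in_itv/=; lra.
  rewrite -{1}c0 gc ?lexx ?ler01 ?c0 ?c1 ?subr0 ?ger0_norm//; lra.
by split=> [/on_geodesic_unique|-> //]; apply.
Qed.

(* Main.v *)
Require Import Defs.
From HB Require Import structures.
From mathcomp Require Import all_boot all_order all_algebra.
From mathcomp Require Import all_classical all_reals all_analysis.
From mathcomp Require Import ring lra.
Import Order.TTheory GRing.Theory Num.Theory.
Import numFieldNormedType.Exports.
Local Open Scope ring_scope.

(** Each iterate is a point of a geodesic issued from the anchor [x0], so
    convexity of the metric turns the recursion into linear inequalities.

    Two points [gcomb lambda x y] and [gcomb lambda x' y'] sit at the same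
    parameter [1 - lambda] of their geodesics, so their distance is at most
    [lambda * mdist x x' + (1 - lambda) * mdist y y'] ([mdist_gcomb]).  With a
    common anchor the first term vanishes: consecutive iterates approach each
    other at the rate [(1 - lambda) * gamma] ([halpern_step]).  The residual
    [mdist (T (x k.+1)) (x k.+1)] is bounded by passing through [T (x k)]: the
    first leg is controlled by the Lipschitz condition and [halpern_step], the
    second is [lambda * mdist x0 (T (x k))], a multiple of
    [mdist x0 (x k.+1)] ([halpern_residual]).  When [T] is nonexpansive, the
    same inequality against a fixed point [xs], which is its own combination,
    keeps every iterate within [mdist x0 xs] of [xs] ([halpern_bounded]).

    For [lambda = eps / (4 * D + eps)] the term proportional to [lambda] is at
    most [eps / 2], and the geometric term is at most [eps / 2] as soon as [k]
    exceeds the stated quotient of logarithms ([expr_le_ln]).  For the O-bound,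
    put [s = eps / D].  Since [mdist (T x0) x0 <= 2 * D], the regime
    [mdist (T x0) x0 >= eps] forces [s <= 2], whence
    [ln (1 / (1 - lambda)) >= lambda = s / (4 + s) >= s / 6]: the denominators
    are comparable ([ceil_ln_le]).  The additive constants, [ln 2] in the
    numerator and 1 from the ceiling, are absorbed thanks to the lower bounds
    on the logarithm and on the bound itself, giving
    [C delta = 6 * (1 + ln 2 / ln (1 + delta)) + 1 / delta]. *)

(** * Combinations in a Busemann space *)

Lemma mdist_geodesic_le {R : realType} {G : metricType R} (c c' : R -> G)
    (t : R) :
  busemann G -> geodesic c -> geodesic c' -> 0 <= t <= 1 ->
  mdist (c t) (c' t) <=
    (1 - t) * mdist (c 0) (c' 0) + t * mdist (c 1) (c' 1).
Proof.
move=> [_ cvx] gc gc' /andP[t0 t1].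
have := cvx c c' gc gc' (Itv01 t0 t1) 1 0.
rewrite !inE/= !in_itv/= !lexx ler01 => /(_ isT isT).
have -> : conv (Itv01 t0 t1) (1 : convex_lmodType R^o) 0 = t.
  by rewrite /conv/= scaler0 addr0 /GRing.scale/= mulr1.
by rewrite convRE /= => h; apply: le_trans h _; rewrite addrC.
Qed.

(** Every geodesic from [x] to [y] may be used to compute the combination. *)
Lemma gcomb_geodesic {R : realType} {G : metricType R} (lambda : R) (x y : G)
    (c : R -> G) :
  busemann G -> 0 <= lambda <= 1 -> geodesic_between x y c ->
  gcomb lambda x y = c (1 - lambda).
Proof.
move=> bG l01 [c0 c1 gc]; apply/esym/gcombP => //.
exists c; split=> //.
  by exists (1 - lambda) => //=; rewrite in_itv/=; lra.
rewrite -{1}c0 gc ?lexx ?ler01 ?c0 ?c1 ?subr0 ?ger0_norm//; lra.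
Qed.

Lemma mdist_gcomb {R : realType} {G : metricType R} (lambda : R)
    (x y x' y' : G) :
  busemann G -> 0 <= lambda <= 1 ->
  mdist (gcomb lambda x y) (gcomb lambda x' y') <=
    lambda * mdist x x' + (1 - lambda) * mdist y y'.
Proof.
move=> bG l01; have [c gc] := bG.1 x y; have [c' gc'] := bG.1 x' y'.
rewrite (gcomb_geodesic _ _ _ _ bG l01 gc) (gcomb_geodesic _ _ _ _ bG l01 gc').
case: gc gc' => c0 c1 gc [c'0 c'1 gc'].
have := mdist_geodesic_le _ _ (1 - lambda) bG gc gc'.
by rewrite c0 c1 c'0 c'1 subKr; apply; lra.
Qed.

Lemma mdist_gcomb_left {R : realType} {G : metricType R} (lambda : R)
    (x y : G) :
  busemann G -> 0 <= lambda <= 1 ->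
  mdist x (gcomb lambda x y) = (1 - lambda) * mdist x y.
Proof.
move=> bG l01; have [c gc] := bG.1 x y.
rewrite (gcomb_geodesic _ _ _ _ bG l01 gc); case: gc => c0 c1 gc.
rewrite -{1}c0 gc ?lexx ?ler01 ?c0 ?c1 ?sub0r ?normrN ?ger0_norm//; lra.
Qed.

Lemma mdist_gcomb_right {R : realType} {G : metricType R} (lambda : R)
    (x y : G) :
  busemann G -> 0 <= lambda <= 1 ->
  mdist y (gcomb lambda x y) = lambda * mdist x y.
Proof.
move=> bG l01; have [c gc] := bG.1 x y.
rewrite (gcomb_geodesic _ _ _ _ bG l01 gc); case: gc => c0 c1 gc.
by rewrite -{1}c1 gc ?lexx ?ler01 ?c0 ?c1 ?subKr ?ger0_norm//; lra.
Qed.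

Lemma gcombxx {R : realType} {G : metricType R} (lambda : R) (x : G) :
  busemann G -> 0 <= lambda <= 1 -> gcomb lambda x x = x.
Proof.
move=> bG l01; apply/esym/mdist_positivity.
by rewrite mdist_gcomb_left// mdistxx mulr0.
Qed.

(** * The Halpern iteration *)

(** [x] is the sequence of Halpern iterates of [T] anchored at [x0], with
    constant weight [lambda] on the anchor. *)
Definition halpern {R : realType} {G : metricType R} (T : G -> G) (lambda : R)
    (x0 : G) (x : nat -> G) :=
  x 0%N = x0 /\ forall k, x k.+1 = gcomb lambda x0 (T (x k)).

(** The constant is a parameter: the quantitative bounds depend on it. *)
Definition lipschitz_with {R : realType} {G : metricType R} (gamma : R)
    (T : G -> G) :=
  forall u v, mdist (T u) (T v) <= gamma * mdist u v.

Lemma halpern_step {R : realType} {G : metricType R} (T : G -> G)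
    (gamma lambda : R) (x0 : G) (x : nat -> G) (k : nat) :
  busemann G -> 0 <= gamma -> lipschitz_with gamma T -> 0 <= lambda <= 1 ->
  halpern T lambda x0 x ->
  mdist (x k.+1) (x k) <=
    (1 - lambda) ^+ k.+1 * gamma ^+ k * mdist (T x0) x0.
Proof.
move=> bG g0 lipT l01 [xz xS]; elim: k => [|k IH].
  rewrite xS xz metric_sym mdist_gcomb_left// expr1 expr0 mulr1.
  by rewrite [mdist x0 _]metric_sym.
rewrite (xS k.+1) {2}(xS k).
apply: le_trans (mdist_gcomb _ _ _ _ _ bG l01) _; rewrite mdistxx mulr0 add0r.
rewrite exprS -!mulrA ler_wpM2l//; first lra.
apply: le_trans (lipT _ _) _.
by rewrite [gamma ^+ _]exprS -mulrA mulrCA ler_wpM2l// mulrA.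
Qed.

Lemma halpern_residual {R : realType} {G : metricType R} (T : G -> G)
    (gamma lambda : R) (x0 : G) (x : nat -> G) (k : nat) :
  busemann G -> 0 <= gamma -> lipschitz_with gamma T -> 0 <= lambda < 1 ->
  halpern T lambda x0 x ->
  mdist (T (x k.+1)) (x k.+1) <=
    (1 - lambda) ^+ k.+1 * gamma ^+ k.+1 * mdist (T x0) x0 +
    lambda / (1 - lambda) * mdist x0 (x k.+1).
Proof.
move=> bG g0 lipT l01 hx; have l01' : 0 <= lambda <= 1 by lra.
apply: le_trans (metric_triangle _ (T (x k)) _) _; apply: lerD.
  apply: le_trans (lipT _ _) _.
  rewrite [gamma ^+ _]exprS mulrCA -[leRHS]mulrA ler_wpM2l//.
  exact: (halpern_step _ _ _ _ _ k bG g0 lipT l01' hx).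
rewrite hx.2 mdist_gcomb_right// mdist_gcomb_left// mulrA divfK//; lra.
Qed.

Lemma halpern_bounded {R : realType} {G : metricType R} (T : G -> G)
    (lambda : R) (x0 xs : G) (x : nat -> G) (k : nat) :
  busemann G -> lipschitz_with 1 T -> 0 <= lambda <= 1 ->
  halpern T lambda x0 x -> T xs = xs ->
  mdist (x k) xs <= mdist x0 xs.
Proof.
move=> bG lipT l01 [xz xS] Txs; elim: k => [|k IH]; first by rewrite xz.
rewrite xS -{1}(gcombxx lambda xs bG l01).
apply: le_trans (mdist_gcomb _ _ _ _ _ bG l01) _.
have := lipT (x k) xs; rewrite Txs mul1r => h; nra.
Qed.

(** The index 0 is included: it is needed when the prescribed number of
    iterations is not positive. *)
Lemma halpern_residual_fixed {R : realType} {G : metricType R} (T : G -> G)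
    (gamma lambda : R) (x0 xs : G) (x : nat -> G) (k : nat) :
  busemann G -> 0 <= gamma <= 1 -> lipschitz_with gamma T ->
  0 <= lambda < 1 -> halpern T lambda x0 x -> T xs = xs ->
  mdist (T (x k)) (x k) <=
    (1 - lambda) ^+ k * gamma ^+ k * mdist (T x0) x0 +
    2 * lambda / (1 - lambda) * mdist x0 xs.
Proof.
move=> bG /andP[g0 g1] lipT l01 hx Txs.
have l0 : 0 <= lambda / (1 - lambda) by rewrite divr_ge0//; lra.
have d0 := mdist_ge0 x0 xs.
case: k => [|k].
  rewrite hx.1 !expr0 !mul1r lerDl; rewrite -mulrA; nra.
apply: le_trans (halpern_residual _ _ _ _ _ k bG g0 lipT l01 hx) _.
rewrite lerD2l.
have -> : 2 * lambda / (1 - lambda) * mdist x0 xs =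
    lambda / (1 - lambda) * (2 * mdist x0 xs) by ring.
apply: ler_wpM2l => //; apply: le_trans (metric_triangle _ xs _) _.
have l01' : 0 <= lambda <= 1 by lra.
have lip1 : lipschitz_with 1 T.
  by move=> u v; apply: le_trans (lipT u v) _; rewrite ler_wpM2r ?mdist_ge0.
have := halpern_bounded _ _ _ _ _ k.+1 bG lip1 l01' hx Txs.
rewrite [mdist (x _) _]metric_sym; lra.
Qed.

(** * Counting iterations *)

Lemma expr_le_ln {R : realType} (q a b : R) (n : nat) :
  0 < q < 1 -> 0 <= a -> 0 < b -> ln (a / b) / ln (1 / q) <= n%:R ->
  q ^+ n * a <= b.
Proof.
move=> /andP[q0 q1] a0 b0.
(* At [a = 0] the logarithm takes a default value and the hypothesis is void. *)
have [->|an0] := eqVneq a 0.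
  by rewrite mulr0 (ltW b0).
have {an0}a0 : 0 < a by rewrite lt_neqAle eq_sym an0.
have iq : 1 < 1 / q by rewrite div1r invf_gt1.
rewrite ler_pdivrMr ?ln_gt0// mulr_natl -lnXn ?(lt_trans ltr01)//.
rewrite ler_ln ?posrE ?divr_gt0 ?exprn_gt0 ?divr_gt0//.
rewrite div1r exprVn ler_pdivrMr// mulrC ler_pdivlMr ?exprn_gt0//.
by rewrite mulrC.
Qed.

Lemma ln_inv_ge {R : realType} (lambda : R) :
  lambda < 1 -> lambda <= ln (1 / (1 - lambda)).
Proof.
move=> l1; rewrite div1r lnV ?posrE ?subr_gt0//.
have : ln (1 + (- lambda)) <= - lambda by apply: le_ln1Dx; lra.
lra.
Qed.

(** The constant of the O-bound, as a function of the margin [delta] by which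
    the logarithm and the bound stay away from 0. *)
Definition halpern_const {R : realType} (delta : R) : R :=
  6 * (1 + ln 2 / ln (1 + delta)) + 1 / delta.

Lemma halpern_const_gt0 {R : realType} (delta : R) :
  0 < delta -> 0 < halpern_const delta.
Proof.
move=> d0; rewrite /halpern_const.
have : 0 < ln 2 / ln (1 + delta) by rewrite divr_gt0 ?ln_gt0//; lra.
have : 0 < 1 / delta by rewrite divr_gt0.
lra.
Qed.

(** [r] stands for [mdist (T x0) x0 / eps], [s] for [eps / D], [A] for
    [ln (1 / (1 - lambda))] and [g] for [ln (1 / gamma)]. *)
Lemma ceil_ln_le {R : realType} (r s A g delta : R) :
  0 < delta -> 1 + delta <= r -> 0 < s -> s / 6 <= A -> 0 <= g ->
  delta <= ln r / (s + g) ->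
  (Num.ceil (ln (2 * r) / (A + g)))%:~R <=
    halpern_const delta * (ln r / (s + g)).
Proof.
move=> d0 dr s0 sA g0; set B := ln r / (s + g) => dB.
have := ceilB1_lt (ln (2 * r) / (A + g)).
rewrite intrD => /= h.
suff : ln (2 * r) / (A + g) <= 6 * (1 + ln 2 / ln (1 + delta)) * B.
  have : 1 <= 1 / delta * B by rewrite mulrC mulrA mulr1 ler_pdivlMr ?mul1r.
  by move: h; rewrite /halpern_const mulrDl; lra.
have l2 : 0 < ln 2 :> R by rewrite ln_gt0//; lra.
have ld : 0 < ln (1 + delta) by rewrite ln_gt0//; lra.
have lr : ln (1 + delta) <= ln r by rewrite ler_ln ?posrE//; lra.
rewrite lnM ?posrE//; last lra.
have num : ln 2 + ln r <= (1 + ln 2 / ln (1 + delta)) * ln r.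
  rewrite addrC mulrDl mul1r lerD2l mulrAC ler_pdivlMr//.
  by rewrite ler_wpM2l// ltW.
have den : (A + g)^-1 <= 6 * (s + g)^-1.
  have -> : 6 * (s + g)^-1 = ((s + g) / 6)^-1 by field; lra.
  rewrite lef_pV2 ?posrE; lra.
have -> : 6 * (1 + ln 2 / ln (1 + delta)) * B =
  (1 + ln 2 / ln (1 + delta)) * ln r * (6 * (s + g)^-1) by rewrite /B; ring.
by apply: ler_pM => //; [lra | rewrite invr_ge0; lra].
Qed.

Theorem lemma3 (R : realType) :
  exists C : R -> R, (forall delta : R, 0 < delta -> 0 < C delta) /\
  forall (G : metricType R) (T : G -> G) (gamma lambda : R) (x0 : G)
    (x : nat -> G),
    busemann G ->
    0 < gamma ->
    (forall u v : G, mdist (T u) (T v) <= gamma * mdist u v) ->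
    0 < lambda < 1 ->
    x 0%N = x0 ->
    (forall k : nat, x k.+1 = gcomb lambda x0 (T (x k))) ->
    (forall k : nat, (1 <= k)%N ->
       mdist (T (x k)) (x k) <=
         (1 - lambda) ^+ k * gamma ^+ k * mdist (T x0) x0 +
         lambda / (1 - lambda) * mdist x0 (x k)) /\
    (gamma <= 1 -> forall xs : G, T xs = xs ->
       (forall k : nat, (1 <= k)%N ->
          mdist (T (x k)) (x k) <=
            (1 - lambda) ^+ k * gamma ^+ k * mdist (T x0) x0 +
            2 * lambda / (1 - lambda) * mdist x0 xs) /\
       (forall (eps D : R) (k : int),
          0 < eps ->
          mdist x0 xs <= D ->
          lambda = eps / (4 * D + eps) ->
          k = Num.ceil (ln (2 * mdist (T x0) x0 / eps) /
                        (ln (1 / (1 - lambda)) + ln (1 / gamma))) ->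
          (forall n : nat, k <= n%:Z -> mdist (T (x n)) (x n) <= eps) /\
          (* The O-bound, in the regime where the logarithm and the bound stay
             away from 0: at mdist (T x0) x0 = eps the bound is 0 while k > 0,
             and as gamma tends to 0 the bound tends to 0 while k >= 1. *)
          (forall delta : R, 0 < delta ->
             1 + delta <= mdist (T x0) x0 / eps ->
             delta <= ln (mdist (T x0) x0 / eps) / (eps / D + ln (1 / gamma)) ->
             k%:~R <= C delta * (ln (mdist (T x0) x0 / eps) /
                                 (eps / D + ln (1 / gamma)))))).
Proof.
exists halpern_const; split=> [delta|]; first exact: halpern_const_gt0.
move=> G T gamma lambda x0 x bG g0 lipT l01 xz xS.
have hx : halpern T lambda x0 x by [].
have g0' := ltW g0; have l01' : 0 <= lambda < 1 by lra.
split=> [[//|k] _|g1 xs Txs].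
  exact: (halpern_residual _ _ _ _ _ k bG g0' lipT l01' hx).
have g01 : 0 <= gamma <= 1 by rewrite g0'.
have res k := halpern_residual_fixed _ _ _ _ _ _ k bG g01 lipT l01' hx Txs.
split=> [k _|eps D k e0 dD lE kE]; first exact: res.
have d0 := mdist_ge0 x0 xs.
(* [lambda < 1] excludes [D = 0]. *)
have D0 : 0 < D.
  rewrite lt_neqAle (le_trans d0 dD) andbT; apply/eqP => D0.
  by move: l01; rewrite lE -D0 mulr0 add0r divff ?gt_eqF// ltxx andbF.
have l1E : lambda / (1 - lambda) = eps / (4 * D) by rewrite lE; field; lra.
have gi0 : 0 <= ln (1 / gamma) by rewrite ln_ge0// div1r invf_ge1.
split=> [n|delta dl0 dr dB]; last first.
  have sE : lambda = (eps / D) / (4 + eps / D) by rewrite lE; field; lra.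
  have TD : mdist (T x0) x0 <= 2 * D.
    apply: le_trans (metric_triangle _ xs _) _.
    have := lipT x0 xs; rewrite Txs [mdist xs x0]metric_sym; nra.
  have s0 : 0 < eps / D by rewrite divr_gt0.
  have s2 : eps / D <= 2.
    by move: dr; rewrite ler_pdivlMr// ler_pdivrMr//; nra.
  rewrite kE -mulrA; apply: ceil_ln_le => //.
  apply: le_trans _ (ln_inv_ge lambda _); last lra.
  rewrite sE; move: s0 s2; move: (eps / D) => s s0 s2.
  rewrite ler_wpM2l ?(ltW s0)// lef_pV2 ?posrE; lra.
rewrite kE ceil_le_int => kn; apply: le_trans (res n) _.
have geo : ((1 - lambda) * gamma) ^+ n * mdist (T x0) x0 <= eps / 2.
  apply: expr_le_ln; rewrite ?mdist_ge0//; [nra|lra|].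
  move: kn; rewrite -lnM ?posrE ?divr_gt0//; try lra.
  rewrite mulf_div mulr1.
  by have -> : 2 * mdist (T x0) x0 / eps = mdist (T x0) x0 / (eps / 2)
    by field; lra.
have lin : 2 * lambda / (1 - lambda) * mdist x0 xs <= eps / 2.
  rewrite -[2 * _ / _]mulrA l1E.
  have -> : eps / 2 = 2 * (eps / (4 * D)) * D by field; lra.
  by rewrite ler_wpM2l// mulr_ge0// divr_ge0; lra.
by rewrite -exprMn; lra.
Qed.
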